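(* Let $d\ge 2$, let $\mathbf m=(m_1,\dots,m_d)$ with all $m_i\ge 1$, and let $U\subseteq P(d,\mathbf m)$ be a color-squarefree monomial order ideal. Then the Stanley-Reisner ideal of $\Delta_{\mathrm{bal}}(U)$, an ideal of $P(d,\mathbf m+(1,\dots,1))$, is $$I_{\Delta_{\mathrm{bal}}(U)}=\langle u : u\in I(U)\text{ squarefree monomial}\rangle+\langle x_{i,\ell}\,x_{i,m_i+1} : 1\le i\le d,\ 1\le \ell\le m_i\rangle .$$
   Context: $P(d,\mathbf m)$ is the polynomial ring over a field $\mathbb K$ in variables $x_{i,j}$, $1\le i\le d$, $1\le j\le m_i$; $x_{i,j}$ has color $i$. It is a subring of $P(d,\mathbf m+(1,\dots,1))$, which has the additional variables $x_{i,m_i+1}$. A monomial is color-squarefree if it is squarefree and divisible by at most one variable of each color. A color-squarefree monomial order ideal is a set $U$ of color-squarefree monomials of $P(d,\mathbf m)$ closed under taking divisors; throughout, it is assumed to contain $1$ and all variables of $P(d,\mathbf m)$. $I(U)$ is the monomial ideal of $P(d,\mathbf m)$ generated by all monomials of $P(d,\mathbf m)$ not in $U$. Balanced squeezed complex: let $V_i=\{1^{(i)},\dots,(m_i+1)^{(i)}\}$. For $u=x_{i_1,j_1}\cdots x_{i_s,j_s}$ color-squarefree with $i_1<\dots<i_s$ put $F_d(u)=\{j_1^{(i_1)},\dots,j_s^{(i_s)}\}\cup\{(m_j+1)^{(j)} : j\in[d]\setminus\{i_1,\dots,i_s\}\}$. Then $\Delta_{\mathrm{bal}}(U)$ is the simplicial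 complex whose facets are the sets $F_d(u)$, $u\in U$. In its Stanley-Reisner ideal (generated by the squarefree monomials corresponding to non-faces) the vertex $j^{(i)}$ corresponds to the variable $x_{i,j}$. *)

(* Defs.v *)
From mathcomp Require Import all_boot all_order all_algebra.
From mathcomp Require Import finmap.
From mathcomp Require Import boolp classical_sets.
From mathcomp Require Import monalg.

Set Implicit Arguments.
Unset Strict Implicit.
Unset Printing Implicit Defensive.

Import GRing.Theory.

Local Open Scope classical_set_scope.
Local Open Scope ring_scope.

(* Ideals are kept as classical sets: the ideals of [ring_quotient] are boolean
   and proper by definition. *)
Section Ideals.
Variable R : comNzRingType.

Definition is_ideal (J : set R) : Prop :=
  [/\ J 0, forall a b, J a -> J b -> J (a + b) & forall r a, J a -> J (r * a)].

Definition ideal_gen (G : set R) : set R := smallest is_ideal G.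

Definition ideal_add (I J : set R) : set R := [set a + b | a in I & b in J].

End Ideals.

Definition mdvd (X : choiceType) (v u : {cmonom X}) : Prop :=
  exists w : {cmonom X}, u = mmul v w.

Definition squarefree (X : choiceType) (u : {cmonom X}) : Prop :=
  forall x, (u x <= 1)%N.

Definition mvar (K : fieldType) (X : choiceType) (x : X) : {malg K[{cmonom X}]} :=
  << ucm x >>.
Arguments mvar K {X} x.

(* A simplicial complex on the finite vertex set [V] is given by its set of
   faces; [complex_of_facets Fs] is the complex generated by [Fs], whose facets
   are the inclusion-maximal members of [Fs]. *)
Definition complex_of_facets (V : finType) (Fs : set {set V}) : set {set V} :=
  [set S | exists2 F, Fs F & S \subset F].

Definition stanley_reisner (K : fieldType) (V : finType) (Delta : set {set V}) :
    set {malg K[{cmonom V}]} :=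
  ideal_gen [set \prod_(v in S) mvar K v | S in ~` Delta].
Arguments stanley_reisner K {V} Delta.

(* Indices start at 0: [Tagged _ j : var m], with tag [i] and [j : 'I_(m i)], is
   the variable x_{i+1,j+1} of P(d,m), and its color is its tag.  The tuple
   m + (1,...,1) is [mS m]; the last variable x_{i,m_i+1} of each color is [vtop]. *)
Notation var m := {i & 'I_(m i)}.

Notation Pring K m := {malg K[{cmonom var m}]}.

Definition mS (d : nat) (m : 'I_d -> nat) : 'I_d -> nat := fun i => (m i).+1.

Section Balanced.
Variables (d : nat) (m : 'I_d -> nat).

Definition vold (x : var m) : var (mS m) :=
  Tagged (fun i => 'I_(mS m i)) (widen_ord (leqnSn _) (tagged x)).

Definition vtop (i : 'I_d) : var (mS m) :=
  Tagged (fun i => 'I_(mS m i)) (@ord_max (m i)).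

(* The inclusion of P(d,m) as a subring of P(d,m+(1,...,1)): the K-algebra map
   sending each variable to the variable with the same name. *)
Definition Pring_incl (K : fieldType) (p : Pring K m) : Pring K (mS m) :=
  mmap (fun c : K => c%:MP)
       (fun u : {cmonom var m} => \prod_(x : var m) mvar K (vold x) ^+ u x) p.

Definition color_squarefree (u : {cmonom var m}) : Prop :=
  squarefree u /\
  forall x y : var m, mdvd (ucm x) u -> mdvd (ucm y) u -> tag x = tag y -> x = y.

Definition color_squarefree_order_ideal (U : set {cmonom var m}) : Prop :=
  [/\ forall u, U u -> color_squarefree u,
      forall u v, U u -> mdvd v u -> U v,
      U mone
    & forall x : var m, U (ucm x)].

Definition I_of (K : fieldType) (U : set {cmonom var m}) : set (Pring K m) :=
  ideal_gen [set (<< u >> : Pring K m) | u in ~` U].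

(* Vertices j^{(i)} are identified with the variables x_{i,j}. *)
Definition F_d (u : {cmonom var m}) : {set var (mS m)} :=
  ([set vold x | x : var m & u x != 0%N] :|:
   [set vtop i | i : 'I_d & [forall x : var m, (tag x == i) ==> (u x == 0%N)]])%SET.

(* On color-squarefree monomials every [F_d u] has cardinality d, so all of these
   sets are facets. *)
Definition Delta_bal (U : set {cmonom var m}) : set {set var (mS m)} :=
  complex_of_facets [set F_d u | u in U].

End Balanced.

Arguments I_of {d m} K U.

(* Main.v *)
Require Import Defs.
From mathcomp Require Import all_boot all_order all_algebra.
From mathcomp Require Import finmap boolp classical_sets monalg.

(** Both ideals are generated by squarefree monomials, so the theorem is a
    description of the non-faces of the balanced squeezed complex.

    Split a vertex set [S] into its old part [A], the variables [x] with
    [vold x] in [S], and its new part, the colors [i] with [vtop i] in [S].  A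
    facet [F_d u] uses in each color either variables of [u] or, when [u] has
    none of that color, the new variable.  Hence [S] is contained in some
    [F_d u] with [u] in [U] exactly when no color contributes to both parts and
    the product of [A] lies in [U] (lemma [Delta_balP]): in one direction that
    product divides [u], and [U] is closed under divisors; in the other,
    [S] is contained in the facet of the product of [A] itself.

    So [S] is a non-face for one of two reasons, matching the two summands.
    Either the monomial of [S] is a multiple of some [x_{i,l} x_{i,m_i+1}], or it
    is a multiple of the squarefree monomial of [A], which is not in [U].
    Conversely each of these generators is the monomial of a non-face.  For the
    first summand this uses that a monomial of [I(U)] is never in [U]
    ([I_of_notin]): since [U] is an order ideal, the polynomials without any
    monomial of [U] form an ideal. *)

Set Implicit Arguments.
Unset Strict Implicit.
Unset Printing Implicit Defensive.

Import GRing.Theory.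

Local Open Scope classical_set_scope.
Local Open Scope ring_scope.

(** * Ideals *)

Section IdealTheory.
Variable R : comNzRingType.
Implicit Types (I J L G : set R).

Lemma ideal_gen_ideal G : is_ideal (ideal_gen G).
Proof.
split=> [L [[L0 _ _] _] // | a b Ga Gb L HL | r a Ga L HL].
  by case: (HL) => -[_ LD _] _; apply: LD; [apply: Ga|apply: Gb].
by case: (HL) => -[_ _ LM] _; apply: LM; apply: Ga.
Qed.

Lemma mem_ideal_gen G a : G a -> ideal_gen G a.
Proof. exact: (sub_gen_smallest (C := @is_ideal R)). Qed.

Lemma ideal_gen_sub G L : is_ideal L -> G `<=` L -> ideal_gen G `<=` L.
Proof. exact: smallest_sub. Qed.

Lemma ideal_add_ideal I J : is_ideal I -> is_ideal J -> is_ideal (ideal_add I J).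
Proof.
move=> [I0 ID IM] [J0 JD JM]; split.
- by exists 0 => //; exists 0 => //; rewrite addr0.
- move=> _ _ [a Ia [b Jb <-]] [a' Ia' [b' Jb' <-]].
  by exists (a + a'); [exact: ID|exists (b + b'); [exact: JD|rewrite addrACA]].
- move=> r _ [a Ia [b Jb <-]].
  by exists (r * a); [exact: IM|exists (r * b); [exact: JM|rewrite mulrDr]].
Qed.

Lemma ideal_addl I J : is_ideal J -> I `<=` ideal_add I J.
Proof. by case=> J0 _ _ a Ia; exists a => //; exists 0 => //; rewrite addr0. Qed.

Lemma ideal_addr I J : is_ideal I -> J `<=` ideal_add I J.
Proof. by case=> I0 _ _ a Ja; exists 0 => //; exists a => //; rewrite add0r. Qed.

Lemma ideal_add_sub I J L :
  is_ideal L -> I `<=` L -> J `<=` L -> ideal_add I J `<=` L.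
Proof.
by move=> [_ LD _] IL JL _ [a Ia [b Jb <-]]; apply: LD; [exact: IL|exact: JL].
Qed.

Lemma ideal_prod_subset (V : finType) (F : V -> R) J (A B : {set V}) :
  is_ideal J -> A \subset B ->
  J (\prod_(v in A) F v) -> J (\prod_(v in B) F v).
Proof.
move=> [_ _ JM] /finset.setIidPr AB JA.
by rewrite (big_setID A) /= AB mulrC; exact: JM.
Qed.

End IdealTheory.

(** * Squarefree monomials and their supports *)

Section SquarefreeMonomials.
Variable V : finType.
Implicit Types (u v : {cmonom V}) (A : {set V}).

Definition msupport u : {set V} := [set x | u x != 0%N]%SET.

Definition set_monom A : {cmonom V} := \big[mmul/mone]_(x in A) ucm x.

Lemma set_monomE A x : set_monom A x = (x \in A).
Proof.
have -> : set_monom A x = (\sum_(y in A) (y == x))%N.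
  rewrite /set_monom.
  by elim/big_rec2: _ => [|y n u _ <-]; rewrite ?cm1 // cmM cmU.
case: (boolP (x \in A)) => [xA|xA].
  by rewrite (bigD1 x) //= eqxx big1 // => y /andP[_ /negbTE ->].
by rewrite big1 // => y yA; case: eqP => // yx; rewrite yx (negbTE xA) in yA.
Qed.

Lemma set_monom_squarefree A : squarefree (set_monom A).
Proof. by move=> x; rewrite set_monomE leq_b1. Qed.

Lemma msupport_set_monom A : msupport (set_monom A) = A.
Proof. by apply/setP => x; rewrite inE set_monomE eqb0 negbK. Qed.

Lemma squarefreeE u x : squarefree u -> u x = (x \in msupport u).
Proof. by move=> /(_ x); rewrite inE; case: (u x) => [|[]]. Qed.

Lemma set_monomK u : squarefree u -> set_monom (msupport u) = u.
Proof.
by move=> sqf; apply/eqP/cmP => x; rewrite set_monomE [RHS]squarefreeE.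
Qed.

(** The exponents of [v] are at most 1, so they are dominated by those of [u]
    as soon as the supports are nested. *)
Lemma squarefree_mdvd u v :
  squarefree v -> msupport v \subset msupport u -> mdvd v u.
Proof.
move=> sqf /fintype.subsetP vu; exists (divcm u v); apply/eqP/cmP => x.
rewrite cmM divcmE subnKC // (squarefreeE x sqf).
by case: (boolP (x \in msupport v)) => // /vu; rewrite inE lt0n.
Qed.

End SquarefreeMonomials.

(** * The complex and its non-faces *)

Section Balanced.
Variables (d : nat) (m : 'I_d -> nat).
Implicit Types (U : set {cmonom var m}) (S : {set var (mS m)}).

(** No monomial of an order ideal enters the ideal generated by the other
    monomials: a monomial of a product [r * p] is a multiple of a monomial of
    [p], so the polynomials whose coefficients vanish on [U] form an ideal. *)
Lemma I_of_notin (K : fieldType) U u :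
  (forall u v, U u -> mdvd v u -> U v) ->
  I_of K U << u >> -> ~ U u.
Proof.
move=> Udvd Iu Uu.
pose J : set (Pring K m) := [set p | forall w, U w -> p@_w = 0].
have J_ideal : is_ideal J.
  split=> [w _ | p q Jp Jq w Uw | r p Jp w Uw]; first by rewrite mcoeff0.
    by rewrite mcoeffD Jp // Jq // addr0.
  apply/eqP; rewrite mcoeff_eq0; apply/negP => /msuppM_le[a [b [_ bp wab]]].
  have Ub : U b by apply: Udvd Uw _; exists a; rewrite wab mulmC.
  by move: bp; rewrite -mcoeff_neq0 Jp // eqxx.
have /(_ _ Iu u Uu) : I_of K U `<=` J.
  apply: ideal_gen_sub => // _ [v nUv <-] w Uw.
  by rewrite mcoeffU1; case: eqP => // vw; case: nUv; rewrite vw.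
by rewrite mcoeffUU => /eqP; rewrite oner_eq0.
Qed.

Lemma vold_inj : injective (@vold d m).
Proof.
move=> [i a] [j b] /eqP; rewrite -tag_eqE /tag_eq /= => /andP[/eqP ij].
move: a b; case: _ / ij => a b; rewrite tagged_asE => /eqP /(congr1 val) /= ab.
by congr existT; apply: val_inj.
Qed.

Lemma vold_neq_vtop (x : var m) i : vold x <> vtop m i.
Proof.
case: x => j a /eqP; rewrite -tag_eqE /tag_eq /= => /andP[/eqP ij].
move: a; case: _ / ij => a; rewrite tagged_asE => /eqP /(congr1 val) /= am.
by have := ltn_ord a; rewrite am ltnn.
Qed.

Lemma vtop_inj : injective (@vtop d m).
Proof. by move=> i j /(congr1 tag). Qed.

Variant vertex_spec : var (mS m) -> Prop :=
  | OldVertex x : vertex_spec (vold x)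
  | NewVertex i : vertex_spec (vtop m i).

Lemma vertexP v : vertex_spec v.
Proof.
case: v => i a; have [am|am] := ltnP a (m i).
  suff -> : existT _ i a = vold (Tagged (fun i => 'I_(m i)) (Ordinal am)).
    by constructor.
  by congr existT; apply: val_inj.
suff -> : existT _ i a = vtop m i by constructor.
congr existT; apply: val_inj => /=.
by apply/eqP; rewrite eqn_leq am andbT -ltnS ltn_ord.
Qed.

Lemma vold_F_d (u : {cmonom var m}) x : (vold x \in F_d u) = (u x != 0%N).
Proof.
rewrite inE (mem_imset _ _ vold_inj) inE orbC; case: imsetP => //= -[i _].
by move/vold_neq_vtop.
Qed.

Lemma vtop_F_d (u : {cmonom var m}) i :
  (vtop m i \in F_d u) = [forall x : var m, (tag x == i) ==> (u x == 0%N)].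
Proof.
rewrite inE (mem_imset _ _ vtop_inj) inE; case: imsetP => //= -[x _].
by move/esym/vold_neq_vtop.
Qed.

Definition old_part S : {set var m} := [set x | vold x \in S]%SET.

(** When [S] is a face, it lies in [F_d u] for some [u] in [U] that may be much
    larger than the old part of [S]; divisor closure allows shrinking [u] to
    the product of that old part, so the condition needs no quantifier
    over [U]. *)
Lemma Delta_balP U S : (forall u v, U u -> mdvd v u -> U v) ->
  Delta_bal U S <->
  U (set_monom (old_part S)) /\
  (forall x : var m, vold x \in S -> vtop m (tag x) \notin S).
Proof.
move=> Udvd; split=> [[_ [u Uu <-] /fintype.subsetP SF] | [US Scol]].
  split=> [|x /SF]; last first.
    rewrite vold_F_d => ux; apply/negP => /SF; rewrite vtop_F_d.
    by move=> /forallP /(_ x); rewrite eqxx (negbTE ux).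
  apply: Udvd Uu _; apply: squarefree_mdvd; first exact: set_monom_squarefree.
  apply/fintype.subsetP => x; rewrite msupport_set_monom !inE => /SF.
  by rewrite vold_F_d.
exists (F_d (set_monom (old_part S))); first by exists (set_monom (old_part S)).
apply/fintype.subsetP => v; case: (vertexP v) => [x xS|i iS].
  by rewrite vold_F_d set_monomE inE xS.
rewrite vtop_F_d; apply/forallP => x; apply/implyP => /eqP xi.
rewrite set_monomE eqb0 inE; apply/negP => /Scol.
by rewrite xi iS.
Qed.

Lemma Pring_incl_squarefree (K : fieldType) (u : {cmonom var m}) :
  squarefree u ->
  Pring_incl (<< u >> : Pring K m) =
  \prod_(v in [set vold x | x in msupport u]%SET) mvar K v.
Proof.
move=> sqf; rewrite /Pring_incl mmapU mul1r big_imset /=; last first.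
  by move=> x y _ _; exact: vold_inj.
rewrite [RHS]big_mkcond; apply: eq_bigr => x _.
by rewrite (squarefreeE x sqf); case: (x \in _).
Qed.

End Balanced.

Theorem theorem3p15 (K : fieldType) (d : nat) (m : 'I_d -> nat)
    (U : set {cmonom var m}) :
  (2 <= d)%N ->
  (forall i, (1 <= m i)%N) ->
  color_squarefree_order_ideal U ->
  stanley_reisner K (Delta_bal U) =
  ideal_add
    (ideal_gen [set Pring_incl (<< u >> : Pring K m)
               | u in [set u | squarefree u /\ I_of K U << u >>]])
    (ideal_gen [set f : Pring K (mS m) | exists (i : 'I_d) (l : 'I_(m i)),
        f = mvar K (vold (Tagged (fun i => 'I_(m i)) l)) * mvar K (vtop m i)]).
Proof.
move=> _ _ [_ Udvd _ _]; apply/seteqP; split.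
- apply: ideal_gen_sub; first by apply: ideal_add_ideal; exact: ideal_gen_ideal.
  move=> _ [S nface <-].
  have [US|nUS] := pselect (U (set_monom (old_part S))).
  + (* The product of the old part is in [U], so only a color clash can keep
       [S] from being a face. *)
    have [x xS topS] : exists2 x : var m, vold x \in S & vtop m (tag x) \in S.
      apply: contrapT => nex; apply: nface; apply/(Delta_balP _ Udvd).
      by split=> // x xS; apply/negP => topS; apply: nex; exists x.
    apply: ideal_addr; first exact: ideal_gen_ideal.
    apply: (ideal_prod_subset (A := [set vold x; vtop m (tag x)]%SET)
              (ideal_gen_ideal _)).
      by rewrite finset.subUset !finset.sub1set xS.
    rewrite big_setU1 ?big_set1 /=; last first.
      by rewrite inE; apply/eqP/vold_neq_vtop.
    by apply: mem_ideal_gen; exists (tag x), (tagged x); case: x {xS topS}.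
  + apply: ideal_addl; first exact: ideal_gen_ideal.
    apply: (ideal_prod_subset (A := [set vold x | x in old_part S]%SET)
              (ideal_gen_ideal _)).
      by apply/fintype.subsetP => _ /imsetP[x xS ->]; rewrite inE in xS.
    apply: mem_ideal_gen; exists (set_monom (old_part S)).
      split; first exact: set_monom_squarefree.
      by apply: mem_ideal_gen; exists (set_monom (old_part S)).
    rewrite Pring_incl_squarefree ?msupport_set_monom //.
    exact: set_monom_squarefree.
- apply: ideal_add_sub; first exact: ideal_gen_ideal.
  + apply: ideal_gen_sub; first exact: ideal_gen_ideal.
    move=> _ [u [sqf Iu] <-]; rewrite Pring_incl_squarefree //.
    apply: mem_ideal_gen; exists [set vold x | x in msupport u]%SET => //.
    move=> /(Delta_balP _ Udvd)[]; suff -> :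
        old_part [set vold x | x in msupport u]%SET = msupport u.
      by rewrite set_monomK // => /(I_of_notin Udvd Iu).
    by apply/setP => x; rewrite inE (mem_imset _ _ (@vold_inj d m)).
  + apply: ideal_gen_sub; first exact: ideal_gen_ideal.
    move=> _ [i [l ->]]; set x : var m := Tagged _ l.
    apply: mem_ideal_gen; exists [set vold x; vtop m i]%SET.
      move=> /(Delta_balP _ Udvd)[_ /(_ x)].
      by rewrite !inE !eqxx orbT => /(_ isT).
    by rewrite big_setU1 ?big_set1 // inE; apply/eqP/vold_neq_vtop.
Qed.
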